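(* Let $\mathrm{Domb}(n)=\sum_{k=0}^{n}\binom{n}{k}^2\binom{2k}{k}\binom{2(n-k)}{n-k}$. Then \begin{align*} &\sum_{n=0}^{\infty}\frac{27+103n+141n^2+78n^3+15n^4}{(n+1)^2(n+2)^2}\frac{\mathrm{Domb}(n)}{(-32)^n}=\frac{18}{\pi},\\ &\sum_{n=0}^{\infty}\frac{239+807n+993n^2+582n^3+165n^4+18n^5}{(n+1)^3(n+2)^3}\frac{\mathrm{Domb}(n)}{(-32)^n}=80-\frac{162}{\pi},\\ &\sum_{n=2}^{\infty}\frac{2+5n-9n^2-21n^3+39n^4}{n^2(n-1)^2}\frac{\mathrm{Domb}(n)}{(-32)^n}=-9\left(\frac{2}{\pi}-\frac{11}{12}\right),\\ &\sum_{n=2}^{\infty}\frac{-26-21n+105n^2-9n^3-147n^4+306n^5}{n^3(n-1)^3}\frac{\mathrm{Domb}(n)}{(-32)^n}=\frac{162}{\pi}-\frac{217}{8},\\ &\sum_{n=0}^{\infty}\frac{5729+8701n+5895n^2+1879n^3+228n^4}{(n+1)^2(n+2)^2(n+3)^2}\frac{\mathrm{Domb}(n)}{(-32)^n}=\frac{486}{\pi}. \end{align*} *)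

(* Defs.v *)
From Stdlib Require Import Reals.
From Coquelicot Require Import Coquelicot.
Open Scope R_scope.

Definition Domb (n : nat) : R :=
  sum_f_R0 (fun k => (Binomial.C n k)^2 * Binomial.C (2*k) k * Binomial.C (2*(n-k)) (n-k)) n.

Definition dterm (n : nat) : R := Domb n / (-32)^n.

(* Main.v *)
Require Import Defs.
From Stdlib Require Import Reals Factorial Lra Lia.
From Coquelicot Require Import Coquelicot.
Open Scope R_scope.

(** All five series reduce to [sum (3n+1) Domb(n) / (-32)^n = 2/PI]: multiplying the three-term
    recurrence of the Domb numbers by a suitable rational function of [n] and summing by parts
    expresses each of them as a multiple of this one plus a telescoping series.

    For that series, let [D] be the generating function of the Domb numbers and put
    [v = 1/(1-16x)], [z = 27/4 (v^2 - v^3)]. Then [D(x) = v Phi(z)] on [-1/32 < x <= 0], where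
    [Phi(z) = 3F2(1/3,1/2,2/3;1,1;z)]. Both sides solve the same third order equation, a symmetric
    square with a singularity at [x = 0], and the invariant bilinear form of such an equation
    vanishes on solutions that are smooth at the singularity; this forces their Wronskian to
    vanish. The point [x = -1/32] corresponds to the branch point [z = 1], and
    [D + 3xD' = v (3v-2) (Phi + 3 z Phi')] with [sqrt(1-z) = (3v-2) sqrt(3v+1) / 2]. The
    coefficients of [Phi + 3 z Phi'] are those of [(1-z)^(-1/2)] times
    [(3n+1) (1/3)_n (2/3)_n / n!^2], which tends to [3 sin(PI/3) / PI] by Euler's sine product, so
    an Abelian theorem gives the value at [z = 1]. *)

(** * The recurrence of the Domb numbers *)

(** Here [n - k] is a free variable [m]: truncated subtraction disappears, the symmetry in [k] and
    [m] becomes visible, and raising [n] at fixed [k] just raises [m]. *)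
Definition domb_summand (k m : nat) : R :=
  (Binomial.C (k + m) k)^2 * Binomial.C (2 * k) k * Binomial.C (2 * m) m.

Lemma Domb_summand (n : nat) :
  Domb n = sum_f_R0 (fun k => domb_summand k (n - k)) n.
Proof.
  unfold Domb, domb_summand. apply sum_eq. intros k Hk.
  replace (k + (n - k))%nat with n by lia. reflexivity.
Qed.

Lemma fact_S_INR (n : nat) : INR (fact (S n)) = (INR n + 1) * INR (fact n).
Proof. rewrite fact_simpl, mult_INR, S_INR. reflexivity. Qed.

Lemma domb_summand_fact (k m : nat) :
  domb_summand k m =
  (INR (fact (k + m)) / (INR (fact k) * INR (fact m)))^2
  * (INR (fact (2 * k)) / INR (fact k) ^ 2) * (INR (fact (2 * m)) / INR (fact m) ^ 2).
Proof.
  unfold domb_summand, Binomial.C.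
  replace (k + m - k)%nat with m by lia.
  replace (2 * k - k)%nat with k by lia.
  replace (2 * m - m)%nat with m by lia.
  field. split; apply INR_fact_neq_0.
Qed.

Lemma domb_summand_pos (k m : nat) : 0 < domb_summand k m.
Proof.
  rewrite domb_summand_fact.
  pose proof (INR_fact_lt_0 k). pose proof (INR_fact_lt_0 m).
  pose proof (INR_fact_lt_0 (k + m)). pose proof (INR_fact_lt_0 (2 * k)).
  pose proof (INR_fact_lt_0 (2 * m)).
  repeat (apply pow_lt || apply Rdiv_lt_0_compat || apply Rmult_lt_0_compat); assumption.
Qed.

Lemma domb_summand_sym (k m : nat) : domb_summand k m = domb_summand m k.
Proof.
  rewrite !domb_summand_fact, (Nat.add_comm m k).
  field. split; apply INR_fact_neq_0.
Qed.

Lemma domb_summand_S_r (k m : nat) :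
  domb_summand k (S m) =
  2 * (2 * INR m + 1) * (INR k + INR m + 1)^2 / (INR m + 1)^3 * domb_summand k m.
Proof.
  rewrite !domb_summand_fact.
  replace (k + S m)%nat with (S (k + m)) by lia.
  replace (2 * S m)%nat with (S (S (2 * m))) by lia.
  rewrite !fact_S_INR, !S_INR, !plus_INR, !mult_INR. simpl (INR 2).
  pose proof (pos_INR m).
  field. repeat split; try apply INR_fact_neq_0; lra.
Qed.

Lemma domb_summand_S_l (k m : nat) :
  domb_summand (S k) m =
  2 * (2 * INR k + 1) * (INR k + INR m + 1)^2 / (INR k + 1)^3 * domb_summand k m.
Proof.
  rewrite (domb_summand_sym (S k)), domb_summand_S_r, (domb_summand_sym m k).
  pose proof (pos_INR k). field. lra.
Qed.

Definition domb_cert (n k : R) : R :=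
  (-224 - 864*n - 1304*n^2 - 960*n^3 - 344*n^4 - 48*n^5)
  + (296 + 948*n + 1112*n^2 + 564*n^3 + 104*n^4) * k
  - (120 + 312*n + 264*n^2 + 72*n^3) * k^2 + (16 + 32*n + 16*n^2) * k^3.

(* Zeilberger's algorithm: [domb_cert] is the polynomial part of the rational certificate. *)
Lemma domb_partial_recurrence (n k : nat) : (k <= n)%nat ->
  (INR n + 2)^3 * sum_f_R0 (fun j => domb_summand j (S (S n) - j)) k
  - 2 * (2 * INR n + 3) * (5 * (INR n + 1)^2 + 5 * (INR n + 1) + 2)
      * sum_f_R0 (fun j => domb_summand j (S n - j)) k
  + 64 * (INR n + 1)^3 * sum_f_R0 (fun j => domb_summand j (n - j)) k
  = (2 * INR k + 1) * domb_cert (INR n) (INR k + 1) / (INR n - INR k + 1)^3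
      * domb_summand k (n - k).
Proof.
  induction k as [|k IH]; intros Hk.
  - simpl sum_f_R0. rewrite !Nat.sub_0_r, !domb_summand_S_r, !S_INR.
    unfold domb_cert. simpl (INR 0). pose proof (pos_INR n).
    field. lra.
  - rewrite !tech5.
    assert (IH' := IH ltac:(lia)). clear IH.
    (* With [n = m + S k] every remaining summand is a rational multiple of [domb_summand k m], so
       the induction step is an identity of rational functions in [k] and [m]. *)
    destruct (Nat.le_exists_sub (S k) n Hk) as [m [Hn _]]. subst n.
    replace (S (S (m + S k)) - S k)%nat with (S (S m)) by lia.
    replace (S (m + S k) - S k)%nat with (S m) by lia.
    replace (m + S k - S k)%nat with m by lia.
    replace (m + S k - k)%nat with (S m) in IH' by lia.
    match type of IH' with ?a * ?s2 - ?b * ?s1 + ?c * ?s0 = ?r =>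
      match goal with |- _ * (_ + ?t2) - _ * (_ + ?t1) + _ * (_ + ?t0) = _ =>
        transitivity ((a * s2 - b * s1 + c * s0) + (a * t2 - b * t1 + c * t0)); [ring|rewrite IH']
      end end.
    rewrite !domb_summand_S_r, !domb_summand_S_l, ?plus_INR, !S_INR.
    unfold domb_cert. pose proof (pos_INR m). pose proof (pos_INR k).
    generalize (domb_summand k m); intros w.
    revert H H0. generalize (INR m) (INR k). clear. intros m k Hm Hk.
    field. repeat split; lra.
Qed.

(** At [k = n] the partial sums miss the last two terms of [Domb (S (S n))] and the last one of
    [Domb (S n)]; these cancel the certificate exactly. *)
Lemma Domb_recurrence (n : nat) :
  (INR n + 2)^3 * Domb (S (S n))
  = 2 * (2 * INR n + 3) * (5 * (INR n + 1)^2 + 5 * (INR n + 1) + 2) * Domb (S n)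
    - 64 * (INR n + 1)^3 * Domb n.
Proof.
  pose proof (domb_partial_recurrence n n (le_n n)) as H.
  rewrite !Domb_summand, !tech5.
  match type of H with ?a * ?s2 - ?b * ?s1 + ?c * ?s0 = ?r =>
    match goal with |- _ * (_ + ?t1 + ?t2) = _ * (_ + ?t3) - _ =>
      enough (a * (t1 + t2) - b * t3 + r = 0) by (rewrite <- H in *; lra)
    end end.
  replace (S (S n) - S n)%nat with 1%nat by lia.
  rewrite !Nat.sub_diag.
  rewrite !domb_summand_S_r, !domb_summand_S_l, !S_INR. unfold domb_cert.
  simpl (INR 0). pose proof (pos_INR n). field. lra.
Qed.

Lemma Domb_0 : Domb 0 = 1.
Proof. unfold Domb, Binomial.C. simpl. field. Qed.

Lemma Domb_1 : Domb 1 = 4.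
Proof. unfold Domb, Binomial.C. simpl. field. Qed.

Lemma Domb_nonneg (n : nat) : 0 <= Domb n.
Proof.
  rewrite Domb_summand. apply cond_pos_sum. intros k. apply Rlt_le, domb_summand_pos.
Qed.

(** Dropping the negative term of the recurrence bounds the ratio of consecutive terms by 20. The
    true growth rate is 16, but 20 already puts [-1/32] inside the disc of convergence. *)
Lemma Domb_le_pow (n : nat) : Domb n <= 20 ^ n.
Proof.
  induction n as [|[|n] IH].
  - rewrite Domb_0. simpl. lra.
  - rewrite Domb_1. simpl. lra.
  - apply Rle_trans with (20 * Domb (S n)); [|simpl in *; lra].
    pose proof (Domb_recurrence n). pose proof (Domb_nonneg n). pose proof (Domb_nonneg (S n)).
    pose proof (pos_INR n) as Hn.
    assert (0 <= (INR n + 1)^3) by (apply pow_le; lra).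
    assert (0 < (INR n + 2)^3) by (apply pow_lt; lra).
    apply Rmult_le_reg_l with ((INR n + 2)^3); [assumption|].
    assert (0 <= 64 * (INR n + 1)^3 * Domb n) by nra.
    assert (2 * (2 * INR n + 3) * (5 * (INR n + 1)^2 + 5 * (INR n + 1) + 2) <= 20 * (INR n + 2)^3)
      by (assert (0 <= INR n ^ 2) by (apply pow_le; lra);
          assert (0 <= INR n ^ 3) by (apply pow_le; lra); nra).
    nra.
Qed.

(** * Euler's sine product at 1/3 *)

Definition wallis_cos (z : R) (n : nat) : R :=
  RInt (fun t => cos t ^ (2 * n) * cos (z * t)) 0 (PI / 2).

Lemma wallis_cos_ex_RInt (z : R) (n : nat) (a b : R) :
  ex_RInt (fun t => cos t ^ n * cos (z * t)) a b.
Proof.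
  apply (ex_RInt_continuous (V := R_CompleteNormedModule)). intros t _.
  apply (ex_derive_continuous (V := R_NormedModule)). auto_derive. trivial.
Qed.

(* Integrate the derivative of [z cos^(2n+2) t sin(zt) - (2n+2) cos^(2n+1) t sin t cos(zt)]. *)
Lemma wallis_cos_S (z : R) (n : nat) :
  (4 * (INR n + 1)^2 - z^2) * wallis_cos z (S n)
  = 2 * (INR n + 1) * (2 * INR n + 1) * wallis_cos z n.
Proof.
  unfold wallis_cos.
  assert (Hm : INR (2 * n) = 2 * INR n) by (rewrite mult_INR; reflexivity).
  revert Hm. replace (2 * S n)%nat with (S (S (2 * n))) by lia.
  generalize (2 * n)%nat. intros m Hm.
  set (H := fun t => z * cos t ^ S (S m) * sin (z * t)
                     - (INR m + 2) * cos t ^ S m * sin t * cos (z * t)).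
  assert (E1 : is_RInt
    (fun t => (INR m + 2) * (INR m + 1) * (cos t ^ m * cos (z * t))
              - ((INR m + 2)^2 - z^2) * (cos t ^ S (S m) * cos (z * t)))
    0 (PI / 2) (minus (H (PI / 2)) (H 0))).
  { apply (is_RInt_derive (V := R_CompleteNormedModule)).
    - intros t _. unfold H. auto_derive; [trivial|].
      pose proof (sin2_cos2 t) as Hsc. unfold Rsqr in Hsc.
      replace (match m with O => 1 | S _ => INR m + 1 end) with (INR m + 1)
        by (destruct m; simpl; ring).
      assert (Hs : sin t * sin t = 1 - cos t * cos t) by lra.
      simpl pow.
      transitivity ((INR m + 2) * (INR m + 1) * cos t ^ m * (sin t * sin t) * cos (z * t)
        + (z^2 - (INR m + 2)) * (cos t * (cos t * cos t ^ m)) * cos (z * t)); [ring|].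
      rewrite Hs. ring.
    - intros t _. apply (ex_derive_continuous (V := R_NormedModule)).
      auto_derive. trivial. }
  (* No boundary terms: [cos] occurs with positive exponent and vanishes at [PI / 2], and each term
     has a sine that vanishes at 0. *)
  assert (H0 : minus (H (PI / 2)) (H 0) = 0).
  { unfold H. rewrite cos_PI2, sin_0, Rmult_0_r, sin_0.
    change (minus ?a ?b) with (a - b). simpl. ring. }
  rewrite H0 in E1.
  assert (E2 := fun k => RInt_correct (V := R_CompleteNormedModule) _ 0 (PI / 2)
    (wallis_cos_ex_RInt z k 0 (PI / 2))).
  pose proof (is_RInt_minus _ _ _ _ _ _ (is_RInt_scal _ _ _ ((INR m + 2) * (INR m + 1)) _ (E2 m))
    (is_RInt_scal _ _ _ ((INR m + 2)^2 - z^2) _ (E2 (S (S m))))) as E3.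
  apply (is_RInt_unique (V := R_CompleteNormedModule)) in E1.
  apply (is_RInt_unique (V := R_CompleteNormedModule)) in E3.
  assert (E4 := eq_trans (eq_sym E1) E3). clear E1 E3.
  unfold minus, plus, opp, scal in E4. simpl in E4. unfold mult in E4. simpl in E4.
  rewrite Hm in E4. simpl pow in *. lra.
Qed.

Lemma wallis_cos_le (y z : R) (n : nat) :
  0 <= y -> y <= z -> z <= 1 -> wallis_cos z n <= wallis_cos y n.
Proof.
  intros Hy Hyz Hz. pose proof PI_RGT_0. apply RInt_le; try apply wallis_cos_ex_RInt; [lra|].
  intros t Ht. apply Rmult_le_compat_l.
  - apply pow_le, cos_ge_0; lra.
  - apply cos_decr_1; nra.
Qed.

Lemma wallis_cos_0_0 : wallis_cos 0 0 = PI / 2.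
Proof.
  unfold wallis_cos. rewrite (RInt_ext _ (fun _ => 1)).
  - rewrite RInt_const. change (scal ?a ?b) with (a * b). ring.
  - intros. rewrite Rmult_0_l, cos_0. simpl. ring.
Qed.

Lemma wallis_cos_0_S (n : nat) :
  (INR n + 1) * wallis_cos 0 (S n) = (INR n + 1 / 2) * wallis_cos 0 n.
Proof.
  pose proof (wallis_cos_S 0 n) as H. pose proof (pos_INR n).
  apply Rmult_eq_reg_l with (4 * (INR n + 1)); [|lra]. lra.
Qed.

Lemma wallis_cos_0_pos (n : nat) : 0 < wallis_cos 0 n.
Proof.
  induction n as [|n IH].
  - rewrite wallis_cos_0_0. pose proof PI_RGT_0. lra.
  - pose proof (wallis_cos_0_S n) as H. pose proof (pos_INR n).
    apply Rmult_lt_reg_l with (INR n + 1); [lra|]. rewrite Rmult_0_r, H.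
    apply Rmult_lt_0_compat; [lra|exact IH].
Qed.

(* [1 - cos t <= sin^2 t] on the domain of integration. *)
Lemma wallis_cos_1_ge (n : nat) : wallis_cos 0 (S n) <= wallis_cos 1 n.
Proof.
  pose proof PI_RGT_0. apply RInt_le; try apply wallis_cos_ex_RInt; [lra|].
  intros t Ht. replace (2 * S n)%nat with (S (S (2 * n))) by lia. simpl pow.
  rewrite Rmult_0_l, cos_0, Rmult_1_l.
  pose proof (COS_bound t). assert (0 <= cos t) by (apply cos_ge_0; lra).
  replace (n + (n + 0))%nat with (2 * n)%nat by lia.
  assert (0 <= cos t ^ (2 * n)) by (apply pow_le; assumption).
  assert (0 <= cos t ^ (2 * n) * cos t * (1 - cos t)) by
    (repeat apply Rmult_le_pos; lra).
  lra.
Qed.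

(** For [0 <= z <= 1] this is the tail of Euler's product, over [j > n], of the factors
    [1 - z^2 / (4 j^2)]; at [n = 0] and [z > 0] it is [sin(PI z / 2) / (PI z / 2)]. *)
Definition wallis_ratio (z : R) (n : nat) : R := wallis_cos z n / wallis_cos 0 n.

Lemma wallis_ratio_S (z : R) (n : nat) :
  (1 - z^2 / (4 * (INR n + 1)^2)) * wallis_ratio z (S n) = wallis_ratio z n.
Proof.
  unfold wallis_ratio. pose proof (pos_INR n).
  pose proof (wallis_cos_S z n) as Hz. pose proof (wallis_cos_0_S n) as H0.
  pose proof (wallis_cos_0_pos n). pose proof (wallis_cos_0_pos (S n)).
  assert (E : wallis_cos 0 (S n) = (INR n + 1 / 2) / (INR n + 1) * wallis_cos 0 n)
    by (apply Rmult_eq_reg_l with (INR n + 1); [rewrite H0; field; lra|lra]).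
  rewrite E.
  transitivity ((4 * (INR n + 1)^2 - z^2) * wallis_cos z (S n)
    / (4 * (INR n + 1) * (INR n + 1 / 2) * wallis_cos 0 n)).
  - field. lra.
  - rewrite Hz. field. lra.
Qed.

(** Squeeze: [wallis_cos] decreases in [z], so the ratio is at most its value 1 at [z = 0] and at
    least its value at [z = 1], which is no less than [wallis_cos 0 (S n) / wallis_cos 0 n = 1 - 1 /
    (2 (n+1))]. *)
Lemma wallis_ratio_lim (z : R) : 0 <= z <= 1 -> is_lim_seq (wallis_ratio z) 1.
Proof.
  intros Hz.
  apply is_lim_seq_le_le with (u := fun n => 1 - / 2 * / (INR (S n))) (w := fun _ => 1).
  - intros n. pose proof (wallis_cos_0_pos n). pose proof (pos_INR n).
    unfold wallis_ratio. split.
    + apply Rle_trans with (wallis_cos 0 (S n) / wallis_cos 0 n).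
      * apply Req_le. apply Rmult_eq_reg_r with (wallis_cos 0 n); [|lra].
        transitivity (wallis_cos 0 (S n)); [|field; lra].
        apply Rmult_eq_reg_l with (INR n + 1); [|lra].
        rewrite wallis_cos_0_S, S_INR. field. lra.
      * apply Rmult_le_compat_r; [apply Rlt_le, Rinv_0_lt_compat; assumption|].
        apply Rle_trans with (wallis_cos 1 n); [apply wallis_cos_1_ge|].
        apply wallis_cos_le; lra.
    + apply Rmult_le_reg_r with (wallis_cos 0 n); [assumption|].
      unfold Rdiv. rewrite Rmult_assoc, Rinv_l, Rmult_1_r, Rmult_1_l by lra.
      apply wallis_cos_le; lra.
  - replace (Finite 1) with (Rbar_minus 1 (Rbar_mult (/ 2) 0)).
    + apply is_lim_seq_minus'; [apply is_lim_seq_const|].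
      apply is_lim_seq_mult'; [apply is_lim_seq_const|].
      replace (Finite 0) with (Rbar_inv p_infty) by reflexivity.
      apply is_lim_seq_inv; [|discriminate].
      apply -> is_lim_seq_incr_1. apply is_lim_seq_INR.
    + simpl. f_equal. ring.
  - apply is_lim_seq_const.
Qed.

Lemma wallis_ratio_0 : wallis_ratio (2 / 3) 0 = 3 * sqrt 3 / (2 * PI).
Proof.
  unfold wallis_ratio. rewrite wallis_cos_0_0.
  assert (E : wallis_cos (2 / 3) 0 = 3 / 2 * sin (2 / 3 * (PI / 2))).
  { unfold wallis_cos. apply is_RInt_unique.
    replace (3 / 2 * sin (2 / 3 * (PI / 2)))
      with (minus (3 / 2 * sin (2 / 3 * (PI / 2))) (3 / 2 * sin (2 / 3 * 0)))
      by (rewrite (Rmult_0_r (2 / 3)), sin_0; unfold minus, plus, opp; simpl; ring).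
    apply (is_RInt_derive (V := R_CompleteNormedModule) (fun t => 3 / 2 * sin (2 / 3 * t))).
    - intros t _. auto_derive; [trivial|]. simpl. field.
    - intros t _. apply (ex_derive_continuous (V := R_NormedModule)). auto_derive. trivial. }
  rewrite E. replace (2 / 3 * (PI / 2)) with (PI / 3) by field. rewrite sin_PI3.
  field. apply PI_neq0.
Qed.

(* [(1/3)_n (2/3)_n / n!^2] *)
Fixpoint cubic_coef (n : nat) : R :=
  match n with
  | O => 1
  | S m => cubic_coef m * ((INR m + 1 / 3) * (INR m + 2 / 3)) / (INR m + 1)^2
  end.

(** Pairing [j - 1/3] with [j + 1/3] turns [cubic_coef (S n)] into [(n + 2/3) / (3 (n+1)^2)] times
    the first [n] factors [1 - 1/(9 j^2)] of Euler's product, whose product is [wallis_ratio (2/3) 0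
    / wallis_ratio (2/3) n]. *)
Lemma cubic_coef_wallis (n : nat) :
  3 * (INR n + 1)^2 * cubic_coef (S n) * wallis_ratio (2 / 3) n
  = (INR n + 2 / 3) * wallis_ratio (2 / 3) 0.
Proof.
  induction n as [|n IH].
  - simpl. field.
  - rewrite <- (wallis_ratio_S (2 / 3) n) in IH.
    change (cubic_coef (S (S n))) with
      (cubic_coef (S n) * ((INR (S n) + 1 / 3) * (INR (S n) + 2 / 3)) / (INR (S n) + 1)^2).
    rewrite S_INR. pose proof (pos_INR n).
    apply Rmult_eq_reg_l with (INR n + 2 / 3); [|lra].
    transitivity ((INR n + 5 / 3) * ((INR n + 2 / 3) * wallis_ratio (2 / 3) 0)); [|field].
    rewrite <- IH. field. lra.
Qed.

Lemma cubic_coef_lim :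
  is_lim_seq (fun n => (1 + 3 * INR n) * cubic_coef n) (3 * sqrt 3 / (2 * PI)).
Proof.
  apply is_lim_seq_incr_1.
  apply is_lim_seq_ext with
    (fun n => (4 + 3 * INR n) * (INR n + 2 / 3) / (3 * (INR n + 1)^2)
              * (wallis_ratio (2 / 3) 0 / wallis_ratio (2 / 3) n)).
  - intros n. pose proof (cubic_coef_wallis n) as H. pose proof (pos_INR n).
    assert (wallis_ratio (2 / 3) n <> 0).
    { intros E. rewrite E, Rmult_0_r in H.
      assert (0 < wallis_ratio (2 / 3) 0).
      { rewrite wallis_ratio_0. pose proof PI_RGT_0. pose proof (sqrt_lt_R0 3).
        apply Rdiv_lt_0_compat; lra. }
      nra. }
    apply Rmult_eq_reg_l with (3 * (INR n + 1)^2 * wallis_ratio (2 / 3) n).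
    + transitivity ((4 + 3 * INR n) * ((INR n + 2 / 3) * wallis_ratio (2 / 3) 0)).
      * field. split; [assumption|lra].
      * rewrite <- H, S_INR. ring.
    + apply Rmult_integral_contrapositive_currified; [|assumption].
      apply Rgt_not_eq. apply Rmult_lt_0_compat; [lra|]. apply pow_lt; lra.
  - assert (Hinv : is_lim_seq (fun n => / (INR n + 1)) 0).
    { apply is_lim_seq_ext with (fun n => / INR (S n)); [intros; rewrite S_INR; reflexivity|].
      replace (Finite 0) with (Rbar_inv p_infty) by reflexivity.
      apply is_lim_seq_inv; [|discriminate].
      apply -> is_lim_seq_incr_1. apply is_lim_seq_INR. }
    assert (H1 : is_lim_seq (fun n => (4 + 3 * INR n) * (INR n + 2 / 3) / (3 * (INR n + 1)^2)) 1).
    { apply is_lim_seq_ext with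
        (fun n => (1 + / 3 * / (INR n + 1)) * (1 - / 3 * / (INR n + 1))).
      - intros n. pose proof (pos_INR n). field. lra.
      - replace 1 with ((1 + / 3 * 0) * (1 - / 3 * 0)) at 1 by ring.
        apply is_lim_seq_mult'.
        + apply is_lim_seq_plus'; [apply is_lim_seq_const|].
          apply is_lim_seq_mult'; [apply is_lim_seq_const|exact Hinv].
        + apply is_lim_seq_minus'; [apply is_lim_seq_const|].
          apply is_lim_seq_mult'; [apply is_lim_seq_const|exact Hinv]. }
    replace (3 * sqrt 3 / (2 * PI)) with (1 * (wallis_ratio (2 / 3) 0 / 1))
      by (rewrite wallis_ratio_0; field; apply PI_neq0).
    apply is_lim_seq_mult'; [exact H1|].
    apply is_lim_seq_div'; [apply is_lim_seq_const|apply wallis_ratio_lim; lra|lra].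
Qed.

(** * Power series and an Abelian theorem *)

Lemma CV_radius_gt_of_geometric_bound (a : nat -> R) (M r x : R) :
  0 < r -> (forall n, Rabs (a n) <= M * r ^ n) -> Rabs x * r < 1 ->
  Rbar_lt (Rabs x) (CV_radius a).
Proof.
  intros Hr Ha Hx. apply Rbar_lt_le_trans with (Finite (/ r)).
  - simpl. apply Rmult_lt_reg_r with r; [assumption|]. rewrite Rinv_l; lra.
  - apply (proj1 (CV_radius_bounded a)). exists M. intros n.
    rewrite Rabs_mult, <- RPow_abs, (Rabs_pos_eq (/ r)) by (apply Rlt_le, Rinv_0_lt_compat, Hr).
    rewrite pow_inv. apply Rmult_le_reg_r with (r ^ n); [apply pow_lt, Hr|].
    rewrite Rmult_assoc, Rinv_l, Rmult_1_r; [apply Ha|apply pow_nonzero; lra].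
Qed.

(** Handles one term [c x^k y] of a linear differential equation. Adding such terms and applying
    [is_pseries_zero] reduces the equation to a recurrence of coefficients. *)
Lemma is_pseries_monomial (a : nat -> R) (k : nat) (c x : R) :
  Rbar_lt (Rabs x) (CV_radius a) ->
  is_pseries (PS_incr_n (PS_scal c a) k) x (x ^ k * (c * PSeries a x)).
Proof.
  intros Hx. assert (H : is_pseries a x (PSeries a x)).
  { apply PSeries_correct, CV_radius_inside, Hx. }
  replace (x ^ k) with (pow_n x k) by apply pow_n_pow.
  apply (is_pseries_incr_n (V := R_NormedModule)).
  apply (is_pseries_scal (V := R_NormedModule)); [apply Rmult_comm|exact H].
Qed.

Lemma is_pseries_zero (a : nat -> R) (x l : R) :
  (forall n, a n = 0) -> is_pseries a x l -> l = 0.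
Proof.
  intros Ha H. apply is_pseries_unique in H. rewrite <- H.
  rewrite (PSeries_ext _ (fun _ => 0) x Ha). apply PSeries_const_0.
Qed.

Lemma pow_unit_interval (x : R) (n : nat) : 0 <= x <= 1 -> 0 <= x ^ n <= 1.
Proof.
  intros Hx. split; [apply pow_le, Hx|].
  pose proof (pow_incr x 1 n Hx) as H. rewrite pow1 in H. exact H.
Qed.

(* [(1/2)_n / n!] *)
Fixpoint half_coef (n : nat) : R :=
  match n with
  | O => 1
  | S m => half_coef m * (INR m + 1 / 2) / (INR m + 1)
  end.

Lemma half_coef_bound (n : nat) : 0 <= half_coef n <= 1.
Proof.
  induction n as [|n IH]; [simpl; lra|].
  change (half_coef (S n)) with (half_coef n * (INR n + 1 / 2) / (INR n + 1)).
  pose proof (pos_INR n).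
  replace (half_coef n * (INR n + 1 / 2) / (INR n + 1))
    with (half_coef n * ((INR n + 1 / 2) / (INR n + 1))) by (field; lra).
  assert (0 <= (INR n + 1 / 2) / (INR n + 1) <= 1).
  { split.
    - apply Rlt_le, Rdiv_lt_0_compat; lra.
    - apply Rmult_le_reg_r with (INR n + 1); [lra|].
      unfold Rdiv. rewrite Rmult_assoc, Rinv_l; lra. }
  split; nra.
Qed.

Lemma half_coef_CV (z : R) : Rabs z < 1 -> Rbar_lt (Rabs z) (CV_radius half_coef).
Proof.
  intros Hz. apply CV_radius_gt_of_geometric_bound with 1 1; [lra| |lra].
  intros n. rewrite pow1. pose proof (half_coef_bound n). rewrite Rabs_pos_eq; lra.
Qed.

Lemma eq_of_null_derivative (f : R -> R) (a b : R) :
  (forall x, Rmin a b <= x <= Rmax a b -> ex_derive f x) ->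
  (forall x, Rmin a b < x < Rmax a b -> is_derive f x 0) -> f a = f b.
Proof.
  intros Hc Hf. destruct (MVT_gen f a b (fun _ => 0)) as [c [_ E]].
  - exact Hf.
  - intros x Hx. apply continuity_pt_filterlim, (ex_derive_continuous (V := R_NormedModule)).
    apply Hc, Hx.
  - lra.
Qed.

(** The series [F] solves [(1 - z) F' = F / 2], as its coefficients show ([HO]), so the product has
    zero derivative; its value at 0 is 1. *)
Lemma half_coef_PSeries (z : R) : Rabs z < 1 -> sqrt (1 - z) * PSeries half_coef z = 1.
Proof.
  intros Hz.
  transitivity (sqrt (1 - 0) * PSeries half_coef 0).
  2: { rewrite PSeries_0, Rminus_0_r, sqrt_1. simpl. ring. }
  enough (Hd : forall x, Rmin z 0 <= x <= Rmax z 0 ->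
    is_derive (fun z => sqrt (1 - z) * PSeries half_coef z) x 0).
  { apply (eq_of_null_derivative (fun z => sqrt (1 - z) * PSeries half_coef z)); intros x Hx.
    - exists 0. apply Hd, Hx.
    - apply Hd. lra. }
  intros x Hx.
  assert (Hx1 : Rabs x < 1).
  { revert Hx Hz. unfold Rmin, Rmax, Rabs.
    destruct (Rle_dec z 0), (Rcase_abs x), (Rcase_abs z); lra. }
  clear z Hz Hx. assert (Hx2 := half_coef_CV x Hx1).
  assert (Hx3 : 0 < 1 - x) by (apply Rabs_def2 in Hx1; lra).
  assert (Hd := is_derive_PSeries _ _ Hx2).
  assert (Hx4 : Rbar_lt (Rabs x) (CV_radius (PS_derive half_coef)))
    by (rewrite CV_radius_derive; exact Hx2).
  assert (HO : x ^ 0 * (1 * PSeries (PS_derive half_coef) x)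
    + x ^ 1 * (-1 * PSeries (PS_derive half_coef) x)
    + x ^ 0 * (- (1 / 2) * PSeries half_coef x) = 0).
  { eapply is_pseries_zero.
    2: { apply (is_pseries_plus (V := R_NormedModule));
         [apply (is_pseries_plus (V := R_NormedModule))|];
         apply is_pseries_monomial; assumption. }
    intros [|n]; unfold PS_plus, plus, PS_incr_n, PS_incr_1, PS_scal, PS_derive, scal, mult;
      simpl Hierarchy.plus; cbn -[INR half_coef].
    - simpl. field.
    - change (half_coef (S (S n))) with (half_coef (S n) * (INR (S n) + 1 / 2) / (INR (S n) + 1)).
      rewrite !S_INR. pose proof (pos_INR n). field. lra. }
  evar_last.
  - apply (is_derive_mult (fun z => sqrt (1 - z))); [|exact Hd|apply Rmult_comm].
    apply is_derive_sqrt with (f := fun z => 1 - z) (df := -1); [|assumption].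
    auto_derive; [trivial|ring].
  - unfold plus, mult. simpl.
    assert (Hs : sqrt (1 - x) * sqrt (1 - x) = 1 - x) by (apply sqrt_sqrt; lra).
    assert (Hs0 : 0 < sqrt (1 - x)) by (apply sqrt_lt_R0; assumption).
    apply Rmult_eq_reg_l with (sqrt (1 - x)); [|lra].
    transitivity (sqrt (1 - x) * sqrt (1 - x) * PSeries (PS_derive half_coef) x
      - 1 / 2 * PSeries half_coef x); [field; lra|].
    rewrite Hs. lra.
Qed.

(** The weights [sqrt (1 - z) * half_coef n * z^n] are nonnegative for [0 < z < 1], sum to 1, and
    each tends to 0 as [z] tends to 1; the weighted mean of [c] therefore tends to its limit. *)
Lemma half_coef_abelian (c : nat -> R) (l : R) :
  is_lim_seq c l ->
  filterlim (fun z => sqrt (1 - z) * PSeries (fun n => half_coef n * c n) z)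
    (at_left 1) (locally l).
Proof.
  intros Hc. apply filterlim_locally. intros eps.
  assert (He : 0 < eps / 2) by (pose proof (cond_pos eps); lra).
  destruct (proj2 (is_lim_seq_spec c l) Hc (mkposreal _ He)) as [N HN]. simpl in HN.
  set (K := sum_f_R0 (fun n => Rabs (c n - l)) N).
  assert (HK0 : 0 <= K) by (apply cond_pos_sum; intros; apply Rabs_pos).
  assert (HK : forall n, (n <= N)%nat -> Rabs (c n - l) <= K).
  { unfold K. clear. induction N as [|N IH]; intros n Hn.
    - replace n with 0%nat by lia. simpl. lra.
    - rewrite tech5. destruct (Nat.eq_dec n (S N)) as [->|Hne].
      + assert (0 <= sum_f_R0 (fun n => Rabs (c n - l)) N)
          by (apply cond_pos_sum; intros; apply Rabs_pos). lra.
      + assert (Hn' : (n <= N)%nat) by lia. specialize (IH n Hn').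
        pose proof (Rabs_pos (c (S N) - l)). lra. }
  (* The geometric weight only serves to make the finitely many large deviations summable. *)
  assert (Hd : forall n, Rabs (c n - l) <= eps / 2 + K * 2 ^ N * (1 / 2) ^ n).
  { intros n. assert (0 < 2 ^ N) by (apply pow_lt; lra).
    assert (0 < (1 / 2) ^ n) by (apply pow_lt; lra).
    assert (0 <= K * 2 ^ N) by nra.
    destruct (Nat.le_gt_cases n N) as [Hn|Hn].
    - apply Rle_trans with K; [apply HK, Hn|].
      enough (1 <= 2 ^ N * (1 / 2) ^ n) by nra.
      replace N with (n + (N - n))%nat by lia. rewrite pow_add.
      replace (2 ^ n * 2 ^ (N - n) * (1 / 2) ^ n)
        with (2 ^ (N - n) * (2 ^ n * (1 / 2) ^ n)) by ring.
      rewrite <- Rpow_mult_distr. replace (2 * (1 / 2)) with 1 by field.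
      rewrite pow1, Rmult_1_r. apply pow_R1_Rle; lra.
    - apply Rle_trans with (eps / 2); [apply Rlt_le, HN; lia|nra]. }
  (* The factor 2 is the sum of the geometric series of ratio 1/2, and the added 1 makes [C]
     positive. The neighbourhood of 1 is chosen to force [sqrt (1 - z) * C < eps / 2]. *)
  set (C := 2 * (K * 2 ^ N) + 1).
  assert (HC : 0 < C).
  { unfold C. assert (0 < 2 ^ N) by (apply pow_lt; lra). nra. }
  assert (Hdel : 0 < Rmin 1 ((eps / 2 / C) ^ 2)).
  { apply Rmin_glb_lt; [lra|]. apply pow_lt, Rdiv_lt_0_compat; assumption. }
  exists (mkposreal _ Hdel). intros z Hz Hz1.
  change (Rabs (z - 1) < Rmin 1 ((eps / 2 / C) ^ 2)) in Hz.
  apply Rmin_Rgt in Hz. destruct Hz as [Hza Hzb].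
  rewrite Rabs_left in Hza, Hzb by lra.
  assert (Hz0 : 0 < z) by lra.
  assert (Hzabs : Rabs z < 1) by (rewrite Rabs_pos_eq; lra).
  assert (Hsqrt : sqrt (1 - z) < eps / 2 / C).
  { rewrite <- (sqrt_pow2 (eps / 2 / C)) by (apply Rlt_le, Rdiv_lt_0_compat; assumption).
    apply sqrt_lt_1; lra. }
  change (Rabs (sqrt (1 - z) * PSeries (fun n => half_coef n * c n) z - l) < eps).
  assert (Hb : forall n, Rabs (half_coef n * (c n - l)) <= eps / 2 + K * 2 ^ N).
  { intros n. pose proof (half_coef_bound n). rewrite Rabs_mult, (Rabs_pos_eq (half_coef n)) by lra.
    pose proof (Rabs_pos (c n - l)). specialize (Hd n).
    assert (0 <= (1 / 2) ^ n <= 1) by (apply pow_unit_interval; lra).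
    assert (0 <= K * 2 ^ N) by (unfold C in HC; apply Rmult_le_pos; [assumption|apply pow_le; lra]).
    nra. }
  assert (Hcv : Rbar_lt (Rabs z) (CV_radius (fun n => half_coef n * (c n - l)))).
  { apply CV_radius_gt_of_geometric_bound with (eps / 2 + K * 2 ^ N) 1; [lra| |lra].
    intros n. rewrite pow1, Rmult_1_r. apply Hb. }
  assert (Hsplit : PSeries (fun n => half_coef n * c n) z
    = PSeries (fun n => half_coef n * (c n - l)) z + l * PSeries half_coef z).
  { rewrite <- PSeries_scal, <- PSeries_plus.
    - apply PSeries_ext. intros n. unfold PS_plus, PS_scal, plus, scal, mult. simpl.
      unfold mult. simpl. ring.
    - apply CV_radius_inside, Hcv.
    - apply (ex_pseries_scal (V := R_NormedModule)); [apply Rmult_comm|].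
      apply CV_radius_inside, half_coef_CV, Hzabs. }
  rewrite Hsplit, Rmult_plus_distr_l.
  replace (sqrt (1 - z) * (l * PSeries half_coef z))
    with (l * (sqrt (1 - z) * PSeries half_coef z)) by ring.
  rewrite (half_coef_PSeries z Hzabs), Rmult_1_r.
  match goal with |- Rabs (?a + l - l) < _ => replace (a + l - l) with a by ring end.
  rewrite Rabs_mult.
  rewrite (Rabs_pos_eq (sqrt (1 - z))) by apply sqrt_pos.
  assert (Hg : is_series (fun n => (1 / 2) ^ n) (/ (1 - 1 / 2))).
  { apply is_series_geom. rewrite Rabs_pos_eq; lra. }
  assert (Hh : is_series (fun n => half_coef n * z ^ n) (PSeries half_coef z)).
  { apply Series_correct, (ex_series_ext (fun n => scal (pow_n z n) (half_coef n))).
    - intros n. rewrite pow_n_pow. apply Rmult_comm.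
    - apply CV_radius_inside, half_coef_CV, Hzabs. }
  assert (Hmaj : is_series (fun n => eps / 2 * (half_coef n * z ^ n) + K * 2 ^ N * (1 / 2) ^ n)
    (eps / 2 * PSeries half_coef z + K * 2 ^ N * (/ (1 - 1 / 2)))).
  { apply (is_series_plus (V := R_NormedModule));
      apply (is_series_scal (V := R_NormedModule)); assumption. }
  assert (Hle : Rabs (PSeries (fun n => half_coef n * (c n - l)) z)
    <= eps / 2 * PSeries half_coef z + K * 2 ^ N * (/ (1 - 1 / 2))).
  { assert (Hterm : forall n, 0 <= Rabs (half_coef n * (c n - l) * z ^ n)
      <= eps / 2 * (half_coef n * z ^ n) + K * 2 ^ N * (1 / 2) ^ n).
    { intros n. split; [apply Rabs_pos|].
      pose proof (half_coef_bound n).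
      rewrite !Rabs_mult, (Rabs_pos_eq (half_coef n)) by lra.
      assert (Hzn : 0 <= z ^ n <= 1) by (apply pow_unit_interval; lra).
      rewrite (Rabs_pos_eq (z ^ n)) by lra.
      assert (0 <= half_coef n * z ^ n <= 1) by (split; nra).
      assert (0 <= K * 2 ^ N * (1 / 2) ^ n)
        by (repeat apply Rmult_le_pos; try apply pow_le; lra).
      specialize (Hd n). pose proof (Rabs_pos (c n - l)).
      replace (half_coef n * Rabs (c n - l) * z ^ n)
        with (half_coef n * z ^ n * Rabs (c n - l)) by ring.
      nra. }
    apply Rle_trans with (Series (fun n => Rabs (half_coef n * (c n - l) * z ^ n))).
    - apply Series_Rabs.
      apply (ex_series_le (V := R_CompleteNormedModule)
        _ (fun n => eps / 2 * (half_coef n * z ^ n) + K * 2 ^ N * (1 / 2) ^ n)).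
      + intros n. change (Rabs (Rabs (half_coef n * (c n - l) * z ^ n))
          <= eps / 2 * (half_coef n * z ^ n) + K * 2 ^ N * (1 / 2) ^ n).
        rewrite Rabs_Rabsolu. apply Hterm.
      + eexists; exact Hmaj.
    - rewrite <- (is_series_unique _ _ Hmaj). apply Series_le; [exact Hterm|].
      eexists; exact Hmaj. }
  pose proof (sqrt_pos (1 - z)).
  apply Rle_lt_trans with
    (sqrt (1 - z) * (eps / 2 * PSeries half_coef z + K * 2 ^ N * / (1 - 1 / 2))).
  { apply Rmult_le_compat_l; assumption. }
  replace (sqrt (1 - z) * (eps / 2 * PSeries half_coef z + K * 2 ^ N * / (1 - 1 / 2)))
    with (eps / 2 * (sqrt (1 - z) * PSeries half_coef z) + sqrt (1 - z) * (2 * (K * 2 ^ N)))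
    by (field).
  rewrite (half_coef_PSeries z Hzabs).
  assert (sqrt (1 - z) * C < eps / 2).
  { apply Rmult_lt_reg_r with (/ C); [apply Rinv_0_lt_compat, HC|].
    rewrite Rmult_assoc, Rinv_r, Rmult_1_r by lra. exact Hsqrt. }
  unfold C in *. nra.
Qed.

(** * The differential equation of the Domb generating function *)

(** The recurrence as an operator, divided by [x]: with [T = x d/dx] it is [T^3 - 2x
    (2T+1)(5T^2+5T+2) + 64 x^2 (T+1)^3]. The leading coefficient [x^2 (1-4x)(1-16x)] vanishes on
    [x <= 0] only at 0. *)
Definition domb_ode (x y0 y1 y2 y3 : R) : R :=
  (x^2 - 20 * x^3 + 64 * x^4) * y3 + (3 * x - 90 * x^2 + 384 * x^3) * y2
  + (1 - 68 * x + 448 * x^2) * y1 + (-4 + 64 * x) * y0.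

(** The interval includes the singular point 0, where the local exponents are all 0; asking for
    derivatives there excludes the logarithmic solutions. *)
Definition domb_solution (a : R) (u u1 u2 u3 : R -> R) : Prop :=
  forall x, a <= x <= 0 ->
    is_derive u x (u1 x) /\ is_derive u1 x (u2 x) /\ is_derive u2 x (u3 x)
    /\ domb_ode x (u x) (u1 x) (u2 x) (u3 x) = 0.

(* [domb_ode] is the symmetric square of a second order operator; this is the bilinear form
   that is constant along pairs of solutions of such an equation. *)
Definition domb_form (x u0 u1 u2 w0 w1 w2 : R) : R :=
  (x^2 - 20 * x^3 + 64 * x^4) * (u0 * w2 + u2 * w0 - u1 * w1)
  + (x - 30 * x^2 + 128 * x^3) * (u0 * w1 + u1 * w0) + (-8 * x + 64 * x^2) * (u0 * w0).

(** The derivative of the form is [u] times the equation of [w] plus [w] times the equation of [u],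
    hence zero. At [x = 0] all coefficients of the form vanish while the derivatives are finite, so
    the constant is 0. *)
Lemma domb_form_zero (a : R) (u u1 u2 u3 w w1 w2 w3 : R -> R) :
  domb_solution a u u1 u2 u3 -> domb_solution a w w1 w2 w3 -> a <= 0 ->
  domb_form a (u a) (u1 a) (u2 a) (w a) (w1 a) (w2 a) = 0.
Proof.
  intros Hu Hw Ha.
  set (f := fun x => domb_form x (u x) (u1 x) (u2 x) (w x) (w1 x) (w2 x)).
  change (f a = 0).
  transitivity (f 0); [|unfold f, domb_form; ring].
  assert (Hd : forall x, Rmin a 0 <= x <= Rmax a 0 -> is_derive f x 0).
  { intros x Hx. rewrite Rmin_left, Rmax_right in Hx by lra.
    destruct (Hu x Hx) as (Du0 & Du1 & Du2 & Eu), (Hw x Hx) as (Dw0 & Dw1 & Dw2 & Ew).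
    unfold f, domb_form. auto_derive.
    - repeat split; eexists; eassumption.
    - replace (Derive (fun x => u x) x) with (u1 x) by (symmetry; apply is_derive_unique, Du0).
      replace (Derive (fun x => u1 x) x) with (u2 x) by (symmetry; apply is_derive_unique, Du1).
      replace (Derive (fun x => u2 x) x) with (u3 x) by (symmetry; apply is_derive_unique, Du2).
      replace (Derive (fun x => w x) x) with (w1 x) by (symmetry; apply is_derive_unique, Dw0).
      replace (Derive (fun x => w1 x) x) with (w2 x) by (symmetry; apply is_derive_unique, Dw1).
      replace (Derive (fun x => w2 x) x) with (w3 x) by (symmetry; apply is_derive_unique, Dw2).
      transitivity (u x * domb_ode x (w x) (w1 x) (w2 x) (w3 x)
        + w x * domb_ode x (u x) (u1 x) (u2 x) (u3 x)).
      + unfold domb_ode. ring.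
      + rewrite Eu, Ew. ring. }
  apply eq_of_null_derivative.
  - intros x Hx. exists 0. apply Hd, Hx.
  - intros x Hx. apply Hd. lra.
Qed.

Lemma domb_solution_le (a b : R) (u u1 u2 u3 : R -> R) :
  a <= b -> domb_solution a u u1 u2 u3 -> domb_solution b u u1 u2 u3.
Proof. intros Hab H x Hx. apply H. lra. Qed.

(* The three form identities say that the form vanishes on the span of the two solutions;
   eliminating second derivatives leaves the square of the Wronskian. *)
Lemma domb_solution_wronskian (a : R) (u u1 u2 u3 w w1 w2 w3 : R -> R) :
  domb_solution a u u1 u2 u3 -> domb_solution a w w1 w2 w3 -> a < 0 ->
  u1 a * w a - u a * w1 a = 0.
Proof.
  intros Hu Hw Ha.
  pose proof (domb_form_zero _ _ _ _ _ _ _ _ _ Hu Hu (Rlt_le _ _ Ha)) as Euu.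
  pose proof (domb_form_zero _ _ _ _ _ _ _ _ _ Hu Hw (Rlt_le _ _ Ha)) as Euw.
  pose proof (domb_form_zero _ _ _ _ _ _ _ _ _ Hw Hw (Rlt_le _ _ Ha)) as Eww.
  assert (E : (a^2 * (1 - 20 * a + 64 * a^2)) * (u1 a * w a - u a * w1 a)^2 = 0).
  { transitivity (- (w a ^ 2 * domb_form a (u a) (u1 a) (u2 a) (u a) (u1 a) (u2 a)
      - 2 * u a * w a * domb_form a (u a) (u1 a) (u2 a) (w a) (w1 a) (w2 a)
      + u a ^ 2 * domb_form a (w a) (w1 a) (w2 a) (w a) (w1 a) (w2 a))).
    - unfold domb_form. ring.
    - rewrite Euu, Euw, Eww. ring. }
  apply Rmult_integral in E. destruct E as [E|E].
  - assert (0 < a^2) by nra. nra.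
  - simpl in E. rewrite Rmult_1_r in E. apply Rmult_integral in E. tauto.
Qed.

(** The Wronskian vanishes at every negative point of the interval, so [u / w] is constant, equal to
    its value 1 at 0. The Wronskian at [a] then gives equality of the derivatives. *)
Lemma domb_solution_unique (a : R) (u u1 u2 u3 w w1 w2 w3 : R -> R) :
  domb_solution a u u1 u2 u3 -> domb_solution a w w1 w2 w3 -> a < 0 ->
  (forall x, a <= x <= 0 -> 0 < w x) -> u 0 = w 0 -> u a = w a /\ u1 a = w1 a.
Proof.
  intros Hu Hw Ha Hpos H0.
  assert (E : u a = w a).
  { enough (E : u a / w a = u 0 / w 0).
    { pose proof (Hpos a ltac:(lra)). pose proof (Hpos 0 ltac:(lra)).
      rewrite H0 in E. replace (w 0 / w 0) with 1 in E by (field; lra).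
      replace (u a) with (u a / w a * w a) by (field; lra). rewrite E. ring. }
    assert (Hd : forall x, a <= x <= 0 ->
      is_derive (fun x => u x / w x) x ((u1 x * w x - u x * w1 x) / (w x)^2)).
    { intros x Hx. destruct (Hu x Hx) as (Du0 & _), (Hw x Hx) as (Dw0 & _).
      apply (is_derive_div u w); [assumption|assumption|].
      apply Rgt_not_eq, Hpos, Hx. }
    apply (eq_of_null_derivative (fun x => u x / w x)); intros x Hx;
      rewrite Rmin_left, Rmax_right in Hx by lra.
    - eexists. apply Hd, Hx.
    - replace 0 with ((u1 x * w x - u x * w1 x) / (w x)^2); [apply Hd; lra|].
      rewrite (domb_solution_wronskian x u u1 u2 u3 w w1 w2 w3).
      + unfold Rdiv. ring.
      + apply domb_solution_le with a; [lra|assumption].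
      + apply domb_solution_le with a; [lra|assumption].
      + lra. }
  split; [exact E|].
  pose proof (domb_solution_wronskian _ _ _ _ _ _ _ _ _ Hu Hw Ha) as W.
  pose proof (Hpos a ltac:(lra)). rewrite E in W.
  apply Rmult_eq_reg_r with (w a); [|lra]. lra.
Qed.

Lemma Domb_CV (x : R) : Rabs x * 20 < 1 -> Rbar_lt (Rabs x) (CV_radius Domb).
Proof.
  intros Hx. apply CV_radius_gt_of_geometric_bound with 1 20; [lra| |exact Hx].
  intros n. rewrite Rabs_pos_eq by apply Domb_nonneg. rewrite Rmult_1_l. apply Domb_le_pow.
Qed.

Lemma Domb_solution (a : R) : -1/20 < a ->
  domb_solution a (PSeries Domb) (PSeries (PS_derive Domb))
    (PSeries (PS_derive (PS_derive Domb))) (PSeries (PS_derive (PS_derive (PS_derive Domb)))).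
Proof.
  intros Ha x Hx.
  assert (H0 : Rbar_lt (Rabs x) (CV_radius Domb))
    by (apply Domb_CV; rewrite Rabs_left1; lra).
  assert (H1 : Rbar_lt (Rabs x) (CV_radius (PS_derive Domb)))
    by (rewrite CV_radius_derive; exact H0).
  assert (H2 : Rbar_lt (Rabs x) (CV_radius (PS_derive (PS_derive Domb))))
    by (rewrite CV_radius_derive; exact H1).
  assert (H3 : Rbar_lt (Rabs x) (CV_radius (PS_derive (PS_derive (PS_derive Domb)))))
    by (rewrite CV_radius_derive; exact H2).
  repeat split; try (apply is_derive_PSeries; assumption).
  pose proof (fun k c => is_pseries_monomial _ k c x H0) as M0.
  pose proof (fun k c => is_pseries_monomial _ k c x H1) as M1.
  pose proof (fun k c => is_pseries_monomial _ k c x H2) as M2.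
  pose proof (fun k c => is_pseries_monomial _ k c x H3) as M3.
  pose proof (fun a b l m => @is_pseries_plus _ R_NormedModule a b x l m) as P.
  pose proof (P _ _ _ _ (P _ _ _ _ (M3 2%nat 1) (P _ _ _ _ (M3 3%nat (-20)) (M3 4%nat 64)))
    (P _ _ _ _ (P _ _ _ _ (M2 1%nat 3) (P _ _ _ _ (M2 2%nat (-90)) (M2 3%nat 384)))
    (P _ _ _ _ (P _ _ _ _ (M1 0%nat 1) (P _ _ _ _ (M1 1%nat (-68)) (M1 2%nat 448)))
    (P _ _ _ _ (M0 0%nat (-4)) (M0 1%nat 64))))) as S.
  apply is_pseries_zero in S.
  - rewrite <- S. unfold domb_ode, plus. simpl. ring.
  - clear. pose proof Domb_0. pose proof Domb_1.
    pose proof (Domb_recurrence 0) as R0. pose proof (Domb_recurrence 1) as R1.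
    pose proof (Domb_recurrence 2) as R2.
    simpl (INR 0) in R0. simpl (INR 1) in R1. simpl (INR 2) in R2.
    (* The coefficient of [x^m] is the recurrence at [m - 1], and for [m = 0] the relation
       [Domb 1 = 4 Domb 0]. Indices below 4 are separate because the shift by [x^4] contributes
       nothing there. *)
    intros [|[|[|[|n]]]];
      unfold PS_plus, plus, PS_incr_n, PS_incr_1, PS_scal, PS_derive, scal, zero; cbn -[INR Domb];
      unfold mult; cbn -[INR Domb].
    + simpl INR. lra.
    + simpl INR. lra.
    + simpl INR. lra.
    + simpl INR. lra.
    + pose proof (Domb_recurrence (3 + n)) as Rn.
      rewrite plus_INR in Rn. simpl (INR 3) in Rn. cbn [Nat.add] in Rn.
      replace (n + 1)%nat with (S n) by lia.
      rewrite ?Nat.add_1_r, !S_INR. rewrite ?plus_INR, ?S_INR.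
      lra.
Qed.

(** * The hypergeometric pullback *)

Lemma cubic_coef_bound (n : nat) : 0 <= cubic_coef n <= 1.
Proof.
  induction n as [|n IH]; [simpl; lra|].
  change (cubic_coef (S n))
    with (cubic_coef n * ((INR n + 1 / 3) * (INR n + 2 / 3)) / (INR n + 1)^2).
  pose proof (pos_INR n). unfold Rdiv. rewrite Rmult_assoc.
  assert (0 <= (INR n + 1 * / 3) * (INR n + 2 * / 3) * / (INR n + 1)^2 <= 1).
  { assert (0 < (INR n + 1)^2) by (apply pow_lt; lra). split.
    - apply Rlt_le, Rdiv_lt_0_compat; [nra|assumption].
    - apply Rmult_le_reg_r with ((INR n + 1)^2); [assumption|].
      rewrite Rmult_assoc, Rinv_l; nra. }
  split; nra.
Qed.

(* Coefficients of [3F2(1/3, 1/2, 2/3; 1, 1; z)]. *)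
Definition cubic_3F2_coef (n : nat) : R := half_coef n * cubic_coef n.

Lemma cubic_3F2_coef_S (n : nat) :
  cubic_3F2_coef (S n) = (INR n + 1 / 2) * (INR n + 1 / 3) * (INR n + 2 / 3) / (INR n + 1)^3
    * cubic_3F2_coef n.
Proof.
  unfold cubic_3F2_coef.
  change (cubic_coef (S n))
    with (cubic_coef n * ((INR n + 1 / 3) * (INR n + 2 / 3)) / (INR n + 1)^2).
  change (half_coef (S n)) with (half_coef n * (INR n + 1 / 2) / (INR n + 1)).
  pose proof (pos_INR n). field. lra.
Qed.

Lemma cubic_3F2_coef_bound (n : nat) : 0 <= cubic_3F2_coef n <= 1.
Proof.
  pose proof (half_coef_bound n). pose proof (cubic_coef_bound n).
  unfold cubic_3F2_coef. split; nra.
Qed.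

Lemma cubic_3F2_CV (z : R) : Rabs z < 1 -> Rbar_lt (Rabs z) (CV_radius cubic_3F2_coef).
Proof.
  intros Hz. apply CV_radius_gt_of_geometric_bound with 1 1; [lra| |lra].
  intros n. rewrite pow1. pose proof (cubic_3F2_coef_bound n). rewrite Rabs_pos_eq; lra.
Qed.

Definition cubic_3F2 : R -> R := PSeries cubic_3F2_coef.
Definition cubic_3F2_d1 : R -> R := PSeries (PS_derive cubic_3F2_coef).
Definition cubic_3F2_d2 : R -> R := PSeries (PS_derive (PS_derive cubic_3F2_coef)).
Definition cubic_3F2_d3 : R -> R := PSeries (PS_derive (PS_derive (PS_derive cubic_3F2_coef))).

(** With [T = z d/dz] this is the hypergeometric operator [T^3 - z (T+1/2)(T+1/3)(T+2/3)] divided by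
    [z]; on coefficients it is [cubic_3F2_coef_S]. *)
Lemma cubic_3F2_ode (z : R) : Rabs z < 1 ->
  is_derive cubic_3F2 z (cubic_3F2_d1 z) /\ is_derive cubic_3F2_d1 z (cubic_3F2_d2 z)
  /\ is_derive cubic_3F2_d2 z (cubic_3F2_d3 z)
  /\ (z^2 - z^3) * cubic_3F2_d3 z + (3 * z - 9 / 2 * z^2) * cubic_3F2_d2 z
     + (1 - 29 / 9 * z) * cubic_3F2_d1 z - 1 / 9 * cubic_3F2 z = 0.
Proof.
  intros Hz.
  assert (H0 := cubic_3F2_CV z Hz).
  assert (H1 : Rbar_lt (Rabs z) (CV_radius (PS_derive cubic_3F2_coef)))
    by (rewrite CV_radius_derive; exact H0).
  assert (H2 : Rbar_lt (Rabs z) (CV_radius (PS_derive (PS_derive cubic_3F2_coef))))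
    by (rewrite CV_radius_derive; exact H1).
  assert (H3 : Rbar_lt (Rabs z) (CV_radius (PS_derive (PS_derive (PS_derive cubic_3F2_coef)))))
    by (rewrite CV_radius_derive; exact H2).
  repeat split; try (apply is_derive_PSeries; assumption).
  pose proof (fun k c => is_pseries_monomial _ k c z H0) as M0.
  pose proof (fun k c => is_pseries_monomial _ k c z H1) as M1.
  pose proof (fun k c => is_pseries_monomial _ k c z H2) as M2.
  pose proof (fun k c => is_pseries_monomial _ k c z H3) as M3.
  pose proof (fun a b l m => @is_pseries_plus _ R_NormedModule a b z l m) as P.
  pose proof (P _ _ _ _ (P _ _ _ _ (M3 2%nat 1) (M3 3%nat (-1)))
    (P _ _ _ _ (P _ _ _ _ (M2 1%nat 3) (M2 2%nat (- (9 / 2))))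
    (P _ _ _ _ (P _ _ _ _ (M1 0%nat 1) (M1 1%nat (- (29 / 9)))) (M0 0%nat (- (1 / 9)))))) as S.
  apply is_pseries_zero in S.
  - rewrite <- S. unfold cubic_3F2, cubic_3F2_d1, cubic_3F2_d2, cubic_3F2_d3, plus. simpl. ring.
  - clear. intros [|[|[|n]]];
      unfold PS_plus, plus, PS_incr_n, PS_incr_1, PS_scal, PS_derive, scal, zero;
      cbn -[INR cubic_3F2_coef]; unfold mult; cbn -[INR cubic_3F2_coef];
      rewrite ?Nat.add_1_r, ?cubic_3F2_coef_S.
    1, 2, 3: simpl INR; field.
    rewrite ?S_INR. pose proof (pos_INR n). field. lra.
Qed.

Definition cubic_arg (v : R) : R := 27 / 4 * (v^2 - v^3).

(* With [v = 1/(1-16x)], [pullback_dk] is the [k]-th derivative with respect to [x]. *)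
Definition pullback (v : R) : R := v * cubic_3F2 (cubic_arg v).
Definition pullback_d1 (v : R) : R :=
  16 * v^2 * cubic_3F2 (cubic_arg v) + 108 * (2 * v^4 - 3 * v^5) * cubic_3F2_d1 (cubic_arg v).
Definition pullback_d2 (v : R) : R :=
  512 * v^3 * cubic_3F2 (cubic_arg v) + 1728 * (10 * v^5 - 18 * v^6) * cubic_3F2_d1 (cubic_arg v)
  + 11664 * (4 * v^7 - 12 * v^8 + 9 * v^9) * cubic_3F2_d2 (cubic_arg v).
Definition pullback_d3 (v : R) : R :=
  24576 * v^4 * cubic_3F2 (cubic_arg v)
  + 27648 * (54 * v^6 - 114 * v^7) * cubic_3F2_d1 (cubic_arg v)
  + 186624 * (48 * v^8 - 162 * v^9 + 135 * v^10) * cubic_3F2_d2 (cubic_arg v)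
  + 1259712 * (v^10 * (2 - 3 * v)^3) * cubic_3F2_d3 (cubic_arg v).

(** [1 - cubic_arg v] factors as [(3v-2)^2 (3v+1) / 4], with a double zero at [v = 2/3], the image
    of [x = -1/32]. *)
Lemma cubic_arg_lt_1 (v : R) : 2 / 3 < v -> cubic_arg v < 1.
Proof.
  intros Hv. enough (0 < (3 * v - 2)^2 * (3 * v + 1) / 4) by (unfold cubic_arg; lra).
  assert (0 < (3 * v - 2)^2) by (apply pow_lt; lra). nra.
Qed.

Lemma cubic_arg_bound (v : R) : 2 / 3 < v <= 1 -> 0 <= cubic_arg v < 1.
Proof.
  intros Hv. split.
  - unfold cubic_arg. assert (0 <= v^2 * (1 - v)) by (apply Rmult_le_pos; [apply pow_le|]; lra).
    lra.
  - apply cubic_arg_lt_1. lra.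
Qed.

Lemma cubic_arg_Rabs (v : R) : 2 / 3 < v <= 1 -> Rabs (cubic_arg v) < 1.
Proof. intros Hv. pose proof (cubic_arg_bound v Hv). rewrite Rabs_pos_eq; lra. Qed.

(** Since [dv/dx = 16 v^2] for [v = 1/(1-16x)], derivatives in [x] can be computed in the variable
    [v] alone. *)
Lemma is_derive_comp_inv_linear (H : R -> R) (x d : R) :
  1 - 16 * x <> 0 -> is_derive H (/ (1 - 16 * x)) (d / (16 * (/ (1 - 16 * x))^2)) ->
  is_derive (fun x => H (/ (1 - 16 * x))) x d.
Proof.
  intros Hx HH. evar_last.
  - apply (is_derive_comp H (fun x => / (1 - 16 * x))); [exact HH|].
    auto_derive; [exact Hx|reflexivity].
  - unfold scal. simpl. unfold mult. simpl. field. exact Hx.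
Qed.

Lemma pullback_derive (v : R) : 2 / 3 < v <= 1 ->
  is_derive pullback v (pullback_d1 v / (16 * v^2))
  /\ is_derive pullback_d1 v (pullback_d2 v / (16 * v^2))
  /\ is_derive pullback_d2 v (pullback_d3 v / (16 * v^2)).
Proof.
  intros Hv. destruct (cubic_3F2_ode _ (cubic_arg_Rabs v Hv)) as (D0 & D1 & D2 & _).
  assert (E0 := is_derive_unique _ _ _ D0). assert (E1 := is_derive_unique _ _ _ D1).
  assert (E2 := is_derive_unique _ _ _ D2).
  assert (Hv0 : v <> 0) by lra.
  split; [|split]; unfold pullback, pullback_d1, pullback_d2, pullback_d3, cubic_arg; auto_derive;
    change (27 / 4 * (v^2 - v^3)) with (cubic_arg v);
    change (27 / 4 * (v * (v * 1) + - (v * (v * (v * 1))))) with (cubic_arg v);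
    change (fun x => cubic_3F2 x) with cubic_3F2;
    change (fun x => cubic_3F2_d1 x) with cubic_3F2_d1;
    change (fun x => cubic_3F2_d2 x) with cubic_3F2_d2; rewrite ?E0, ?E1, ?E2;
    try (field; exact Hv0).
  - eexists; eassumption.
  - split; [|split; [|trivial]]; eexists; eassumption.
  - split; [|split; [|split; [|trivial]]]; eexists; eassumption.
Qed.

Lemma pullback_solution (a : R) : -1/32 < a ->
  domb_solution a (fun x => pullback (/ (1 - 16 * x))) (fun x => pullback_d1 (/ (1 - 16 * x)))
    (fun x => pullback_d2 (/ (1 - 16 * x))) (fun x => pullback_d3 (/ (1 - 16 * x))).
Proof.
  intros Ha x Hx.
  assert (Hx1 : 1 - 16 * x <> 0) by lra.
  assert (Hv : 2 / 3 < / (1 - 16 * x) <= 1).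
  { split.
    - apply Rmult_lt_reg_r with (1 - 16 * x); [lra|]. rewrite Rinv_l; lra.
    - apply Rmult_le_reg_r with (1 - 16 * x); [lra|]. rewrite Rinv_l; lra. }
  destruct (pullback_derive _ Hv) as (D0 & D1 & D2).
  split; [|split; [|split]].
  1, 2, 3: apply is_derive_comp_inv_linear; assumption.
  destruct (cubic_3F2_ode _ (cubic_arg_Rabs _ Hv)) as (_ & _ & _ & E).
  assert (Hx2 : x = (/ (1 - 16 * x) - 1) / (16 * / (1 - 16 * x))) by (field; exact Hx1).
  revert Hv E Hx2. generalize (/ (1 - 16 * x)). intros v Hv E ->.
  (* In the variable [v], the Domb operator applied to the pullback is [108 v^2 (2 - 3v)] times the
     hypergeometric operator at [cubic_arg v]. *)
  match type of E with ?o = 0 => transitivity (108 * v^2 * (2 - 3 * v) * o) end.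
  - unfold domb_ode, pullback, pullback_d1, pullback_d2, pullback_d3.
    generalize (cubic_3F2 (cubic_arg v)) (cubic_3F2_d1 (cubic_arg v)) (cubic_3F2_d2 (cubic_arg v))
      (cubic_3F2_d3 (cubic_arg v)).
    unfold cubic_arg. intros p0 p1 p2 p3. field. lra.
  - rewrite E. ring.
Qed.

Lemma cubic_3F2_pos (z : R) : 0 <= z < 1 -> 0 < cubic_3F2 z.
Proof.
  intros Hz. unfold cubic_3F2.
  assert (Hcv : ex_series (fun n => cubic_3F2_coef n * z ^ n)).
  { apply (ex_series_ext (fun n => scal (pow_n z n) (cubic_3F2_coef n))).
    - intros n. rewrite pow_n_pow. apply Rmult_comm.
    - apply CV_radius_inside, cubic_3F2_CV. rewrite Rabs_pos_eq; lra. }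
  unfold PSeries. rewrite Series_incr_1 by exact Hcv.
  apply Rplus_lt_le_0_compat.
  - unfold cubic_3F2_coef. simpl. lra.
  - rewrite <- (Rmult_0_l (Series (fun n => cubic_3F2_coef (S n) * z ^ S n))), <- Series_scal_l.
    apply Series_le; [|apply (ex_series_incr_1 (fun n => cubic_3F2_coef n * z ^ n)), Hcv].
    intros n. assert (0 <= cubic_3F2_coef (S n) * z ^ S n).
    { apply Rmult_le_pos; [apply cubic_3F2_coef_bound|apply pow_le; lra]. }
    lra.
Qed.

(** The range of [v] is that of [-1/32 < x < 0], where [cubic_arg v] stays inside the unit disc.
    Both functions solve the Domb equation on [[x, 0]] and equal 1 at 0. *)
Lemma Domb_PSeries_pullback (v : R) : 2 / 3 < v < 1 ->
  PSeries Domb ((v - 1) / (16 * v)) = pullback v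
  /\ PSeries (PS_derive Domb) ((v - 1) / (16 * v)) = pullback_d1 v.
Proof.
  intros Hv. set (x := (v - 1) / (16 * v)).
  assert (Ev : v = / (1 - 16 * x)) by (unfold x; field; lra).
  assert (Hx : -1/32 < x < 0).
  { assert (0 < (3 * v - 2) / (32 * v)) by (apply Rdiv_lt_0_compat; lra).
    assert (0 < (1 - v) / (16 * v)) by (apply Rdiv_lt_0_compat; lra).
    assert (E1 : x = (3 * v - 2) / (32 * v) - 1 / 32) by (unfold x; field; lra).
    assert (E2 : x = - ((1 - v) / (16 * v))) by (unfold x; field; lra).
    split; lra. }
  rewrite Ev.
  apply (domb_solution_unique x _ _ _ _ (fun x => pullback (/ (1 - 16 * x)))
    (fun x => pullback_d1 (/ (1 - 16 * x))) _ _
    (Domb_solution x ltac:(lra)) (pullback_solution x ltac:(lra))).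
  - lra.
  - intros y Hy.
    assert (Hv' : 2 / 3 < / (1 - 16 * y) <= 1).
    { split.
      - apply Rmult_lt_reg_r with (1 - 16 * y); [lra|]. rewrite Rinv_l; lra.
      - apply Rmult_le_reg_r with (1 - 16 * y); [lra|]. rewrite Rinv_l; lra. }
    unfold pullback. apply Rmult_lt_0_compat; [lra|]. apply cubic_3F2_pos, cubic_arg_bound, Hv'.
  - rewrite PSeries_0, Domb_0. unfold pullback, cubic_3F2.
    replace (/ (1 - 16 * 0)) with 1 by field.
    replace (cubic_arg 1) with 0 by (unfold cubic_arg; ring).
    rewrite PSeries_0. unfold cubic_3F2_coef. simpl. ring.
Qed.

(** The operator [1 + 3 z d/dz] multiplies the coefficient of [z^n] by [1 + 3n]. Keeping [half_coef]
    apart gives the shape to which [half_coef_abelian] applies with the limit [cubic_coef_lim]. *)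
Lemma cubic_3F2_weighted (z : R) : Rabs z < 1 ->
  cubic_3F2 z + 3 * z * cubic_3F2_d1 z
  = PSeries (fun n => half_coef n * ((1 + 3 * INR n) * cubic_coef n)) z.
Proof.
  intros Hz. assert (H0 := cubic_3F2_CV z Hz).
  assert (H1 : Rbar_lt (Rabs z) (CV_radius (PS_derive cubic_3F2_coef)))
    by (rewrite CV_radius_derive; exact H0).
  pose proof (is_pseries_plus _ _ _ _ _ (is_pseries_monomial _ 0 1 z H0)
    (is_pseries_monomial _ 1 3 z H1)) as S.
  apply is_pseries_unique in S.
  etransitivity; [|etransitivity; [symmetry; exact S|]].
  - unfold cubic_3F2, cubic_3F2_d1, plus. simpl. ring.
  - apply PSeries_ext.
    intros [|n]; unfold PS_plus, plus, PS_incr_n, PS_incr_1, PS_scal, PS_derive, scal, zero;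
      cbn -[INR cubic_3F2_coef half_coef cubic_coef]; unfold mult;
      cbn -[INR cubic_3F2_coef half_coef cubic_coef]; unfold cubic_3F2_coef.
    + simpl. ring.
    + rewrite ?Nat.add_1_r, ?S_INR. ring.
Qed.

(** The factor [3v - 2] equals [2 sqrt (1 - z) / sqrt (3v+1)], which is what compensates the blow-up
    of the hypergeometric factor at [z = 1]. At [v = 2/3] the constants combine to [(4/3) / sqrt 3 *
    3 sqrt 3 / (2 PI) = 2 / PI]. *)
Lemma Domb_weighted_lim :
  filterlim (fun v => PSeries Domb ((v - 1) / (16 * v))
      + 3 * ((v - 1) / (16 * v)) * PSeries (PS_derive Domb) ((v - 1) / (16 * v)))
    (at_right (2 / 3)) (locally (2 / PI)).
Proof.
  set (M := PSeries (fun n => half_coef n * ((1 + 3 * INR n) * cubic_coef n))).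
  apply filterlim_ext_loc with
    (fun v => 2 * v / sqrt (3 * v + 1) * (sqrt (1 - cubic_arg v) * M (cubic_arg v))).
  - exists (mkposreal (1 / 3) ltac:(lra)). intros v Hb Hv.
    change (Rabs (v - 2 / 3) < 1 / 3) in Hb. rewrite Rabs_pos_eq in Hb by lra.
    destruct (Domb_PSeries_pullback v ltac:(lra)) as [E0 E1]. rewrite E0, E1.
    pose proof (cubic_arg_bound v ltac:(lra)).
    unfold M. rewrite <- cubic_3F2_weighted by (rewrite Rabs_pos_eq; lra).
    replace (sqrt (1 - cubic_arg v)) with ((3 * v - 2) * sqrt (3 * v + 1) / 2).
    + unfold pullback, pullback_d1. assert (0 < sqrt (3 * v + 1)) by (apply sqrt_lt_R0; lra).
      generalize (cubic_3F2 (cubic_arg v)) (cubic_3F2_d1 (cubic_arg v)).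
      intros p0 p1. unfold cubic_arg. field. lra.
    + replace (1 - cubic_arg v) with (((3 * v - 2) / 2)^2 * (3 * v + 1))
        by (unfold cubic_arg; field).
      rewrite sqrt_mult by (try apply pow_le; lra).
      rewrite sqrt_pow2 by lra. field.
  - replace (2 / PI) with (2 * (2 / 3) / sqrt (3 * (2 / 3) + 1) * (3 * sqrt 3 / (2 * PI))).
    2: { replace (3 * (2 / 3) + 1) with 3 by field.
         field. split; [apply PI_neq0|]. apply Rgt_not_eq, sqrt_lt_R0. lra. }
    apply (filterlim_comp_2 (F := at_right (2 / 3))
      (G := locally (2 * (2 / 3) / sqrt (3 * (2 / 3) + 1))) (H := locally (3 * sqrt 3 / (2 * PI)))
      (fun v => 2 * v / sqrt (3 * v + 1)) (fun v => sqrt (1 - cubic_arg v) * M (cubic_arg v))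
      Rmult).
    + apply (filterlim_filter_le_1 (F := locally (2 / 3))).
      * intros P HP. apply filter_le_within, HP.
      * apply (ex_derive_continuous (V := R_NormedModule) (fun v => 2 * v / sqrt (3 * v + 1))).
        auto_derive. assert (0 < sqrt (3 * (2 / 3) + 1)) by (apply sqrt_lt_R0; lra). lra.
    + apply (filterlim_comp _ _ _ cubic_arg (fun z => sqrt (1 - z) * M z) _ (at_left 1)).
      2: apply half_coef_abelian, cubic_coef_lim.
      assert (Hc : filterlim cubic_arg (locally (2 / 3)) (locally (cubic_arg (2 / 3)))).
      { apply (ex_derive_continuous (V := R_NormedModule)). unfold cubic_arg.
        auto_derive. trivial. }
      replace (cubic_arg (2 / 3)) with 1 in Hc by (unfold cubic_arg; field).
      intros P HP. specialize (Hc _ HP).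
      unfold filtermap, at_right, within in *. revert Hc. apply filter_imp.
      intros v Hv Hv'. apply Hv, cubic_arg_lt_1, Hv'.
    + apply (filterlim_mult (K := R_AbsRing)).
Qed.

(** * Telescoping *)

(** The hypergeometric formula is available only for [v > 2/3], but [-1/32] is interior to the disc
    of convergence of the Domb series, so continuity identifies the value with the one-sided
    limit. *)
Lemma Domb_weighted_value :
  PSeries Domb (-1/32) + 3 * (-1/32) * PSeries (PS_derive Domb) (-1/32) = 2 / PI.
Proof.
  assert (Hcv : Rbar_lt (Rabs (-1/32)) (CV_radius Domb))
    by (apply Domb_CV; rewrite Rabs_left; lra).
  assert (Hcv1 : Rbar_lt (Rabs (-1/32)) (CV_radius (PS_derive Domb)))
    by (rewrite CV_radius_derive; exact Hcv).
  set (S := fun x => PSeries Domb x + 3 * x * PSeries (PS_derive Domb) x).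
  apply (filterlim_locally_unique (K := R_AbsRing) (V := R_NormedModule)
    (F := at_right (2 / 3)) (fun v => S ((v - 1) / (16 * v)))); [|exact Domb_weighted_lim].
  apply (filterlim_filter_le_1 (F := locally (2 / 3))).
  { intros P HP. apply filter_le_within, HP. }
  apply (filterlim_comp _ _ _ (fun v => (v - 1) / (16 * v)) S _ (locally (-1/32))).
  - replace (-1/32) with ((2 / 3 - 1) / (16 * (2 / 3))) by field.
    apply (ex_derive_continuous (V := R_NormedModule) (fun v => (v - 1) / (16 * v))).
    auto_derive. lra.
  - apply (ex_derive_continuous (V := R_NormedModule) S). unfold S. auto_derive.
    split; [|split; [|trivial]]; eexists; apply is_derive_PSeries; assumption.
Qed.

Lemma is_series_dterm_weighted : is_series (fun n => (3 * INR n + 1) * dterm n) (2 / PI).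
Proof.
  rewrite <- Domb_weighted_value.
  assert (Hcv : Rbar_lt (Rabs (-1/32)) (CV_radius Domb))
    by (apply Domb_CV; rewrite Rabs_left; lra).
  assert (Hcv1 : Rbar_lt (Rabs (-1/32)) (CV_radius (PS_derive Domb)))
    by (rewrite CV_radius_derive; exact Hcv).
  pose proof (is_pseries_plus _ _ _ _ _ (is_pseries_monomial _ 0 1 (-1/32) Hcv)
    (is_pseries_monomial _ 1 3 (-1/32) Hcv1)) as S.
  apply (is_series_ext _ (fun n => (3 * INR n + 1) * dterm n)) in S.
  - evar_last; [exact S|]. unfold plus. simpl. field.
  - intros n. unfold dterm. rewrite pow_n_pow.
    replace (-1/32) with (/ -32) by field. rewrite pow_inv.
    assert ((-32) ^ n <> 0) by (apply pow_nonzero; lra).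
    destruct n as [|n]; unfold PS_plus, plus, PS_incr_n, PS_incr_1, PS_scal, PS_derive, scal, zero;
      cbn -[INR Domb pow]; unfold mult; cbn -[INR Domb pow].
    + simpl. field.
    + rewrite ?Nat.add_1_r, ?S_INR. field. assumption.
Qed.

Lemma dterm_recurrence (n : nat) :
  16 * (INR n + 2)^3 * dterm (S (S n))
  + (2 * INR n + 3) * (5 * INR n ^ 2 + 15 * INR n + 12) * dterm (S n)
  + (INR n + 1)^3 * dterm n = 0.
Proof.
  unfold dterm. pose proof (Domb_recurrence n) as H.
  assert ((-32) ^ n <> 0) by (apply pow_nonzero; lra).
  replace ((-32) ^ S (S n)) with (1024 * (-32) ^ n) by (simpl; ring).
  replace ((-32) ^ S n) with (-32 * (-32) ^ n) by (simpl; ring).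
  transitivity (((INR n + 2)^3 * Domb (S (S n))
    - 2 * (2 * INR n + 3) * (5 * (INR n + 1)^2 + 5 * (INR n + 1) + 2) * Domb (S n)
    + 64 * (INR n + 1)^3 * Domb n) / (64 * (-32) ^ n)).
  - field. assumption.
  - rewrite H. unfold Rdiv. ring.
Qed.

(** Convergence of the base series yields this decay, which suffices to kill boundary terms whose
    coefficients grow at most linearly. *)
Lemma dterm_weighted_lim_0 : is_lim_seq (fun n => (3 * INR n + 1) * dterm n) 0.
Proof. apply ex_series_lim_0. eexists. apply is_series_dterm_weighted. Qed.

Lemma linear_growth_dterm_lim_0 (p : nat) (K : R) (f : nat -> R) :
  (forall n, Rabs (f n) <= K * (3 * INR (n + p) + 1)) ->
  is_lim_seq (fun n => f n * dterm (n + p)) 0.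
Proof.
  intros Hf. apply is_lim_seq_abs_0.
  apply is_lim_seq_le_le with (u := fun _ => 0)
    (w := fun n => K * Rabs ((3 * INR (n + p) + 1) * dterm (n + p))).
  - intros n. split; [apply Rabs_pos|].
    pose proof (pos_INR (n + p)). rewrite !Rabs_mult, (Rabs_pos_eq (3 * INR (n + p) + 1)) by lra.
    rewrite <- Rmult_assoc. apply Rmult_le_compat_r; [apply Rabs_pos|apply Hf].
  - apply is_lim_seq_const.
  - rewrite <- (Rmult_0_r K) at 1. apply is_lim_seq_mult'; [apply is_lim_seq_const|].
    apply (is_lim_seq_abs_0 (fun n => (3 * INR (n + p) + 1) * dterm (n + p))).
    apply (is_lim_seq_incr_n (fun n => (3 * INR n + 1) * dterm n)), dterm_weighted_lim_0.
Qed.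

Lemma is_series_telescope (g : nat -> R) :
  is_lim_seq g 0 -> is_series (fun n => g (S n) - g n) (- g 0%nat).
Proof.
  intros Hg.
  change (is_lim_seq (sum_n (fun n => g (S n) - g n)) (- g 0%nat)).
  apply (is_lim_seq_ext (fun n => g (S n) - g 0%nat)).
  - intros n. induction n as [|n IH].
    + rewrite sum_O. reflexivity.
    + rewrite sum_Sn, <- IH. unfold plus. simpl. ring.
  - replace (Finite (- g 0%nat)) with (Finite (0 - g 0%nat)) by (f_equal; ring).
    apply is_lim_seq_minus'; [|apply is_lim_seq_const].
    apply -> (is_lim_seq_incr_1 g). exact Hg.
Qed.

(* Summation by parts against [dterm_recurrence]: [nu] is the multiplier of the recurrence
   at [n], and [A dterm_n + B dterm_(n+1)] is the telescoping part. *)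
Lemma is_series_dterm_telescope (p : nat) (alpha s K : R) (c A B nu : R -> R) :
  (forall x, INR p <= x -> B (x + 1) = 16 * (x + 2)^3 * nu x) ->
  (forall x, INR p <= x -> A (x + 1) = B x + nu x * ((2 * x + 3) * (5 * x^2 + 15 * x + 12))) ->
  (forall x, INR p <= x -> c x = alpha * (3 * x + 1) - A x - nu x * (x + 1)^3) ->
  (forall x, INR p <= x -> Rabs (A x) <= K * (3 * x + 1)) ->
  (forall x, INR p <= x -> Rabs (B x) <= K * (3 * x + 1)) ->
  is_series (fun n => (3 * INR (n + p) + 1) * dterm (n + p)) s ->
  is_series (fun n => c (INR (n + p)) * dterm (n + p))
    (alpha * s - (A (INR p) * dterm p + B (INR p) * dterm (S p))).
Proof.
  intros HB HA Hc KA KB Hs.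
  assert (Hp : forall n, INR p <= INR (n + p)) by (intros n; apply le_INR; lia).
  set (g := fun n => A (INR (n + p)) * dterm (n + p) + B (INR (n + p)) * dterm (S n + p)).
  assert (Hg : is_lim_seq g 0).
  { rewrite <- (Rplus_0_l 0) at 1. apply is_lim_seq_plus'.
    - apply (linear_growth_dterm_lim_0 p K (fun n => A (INR (n + p)))). intros n. apply KA, Hp.
    - apply (is_lim_seq_ext (fun n => B (INR (n + p)) * dterm (n + S p))).
      { intros n. do 2 f_equal. lia. }
      apply (linear_growth_dterm_lim_0 (S p) K (fun n => B (INR (n + p)))). intros n.
      (* [B] multiplies the next term, so its bound must be weakened to the index [n + S p]; this
         needs [0 <= K], which the bound itself forces. *)
      eapply Rle_trans; [apply KB, Hp|].
      assert (HK := Rle_trans _ _ _ (Rabs_pos _) (KB _ (Hp n))).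
      pose proof (pos_INR (n + p)).
      assert (0 <= K).
      { destruct (Rle_or_lt 0 K) as [|HK']; [assumption|]. exfalso. nra. }
      rewrite Nat.add_succ_r, S_INR. nra. }
  pose proof (is_series_plus _ _ _ _ (is_series_scal alpha _ _ Hs) (is_series_telescope g Hg)) as T.
  apply (is_series_ext _ (fun n => c (INR (n + p)) * dterm (n + p))) in T.
  - evar_last; [exact T|]. unfold plus, scal, g. simpl. unfold mult. simpl. ring.
  - intros n. unfold g, plus, scal. cbn -[INR pow]. unfold mult. cbn -[INR pow].
    pose proof (dterm_recurrence (n + p)) as E. specialize (Hp n).
    rewrite S_INR, (HA _ Hp), (HB _ Hp), (Hc _ Hp).
    (* The two sides differ by [nu] times the recurrence: the conditions on [B], [A] and [c] match
       the coefficients of the three consecutive terms. *)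
    match type of E with ?e = 0 =>
      match goal with |- ?l = ?r =>
        transitivity (r + nu (INR (n + p)) * e); [ring|rewrite E; ring] end end.
Qed.

Lemma dterm_values : dterm 0 = 1 /\ dterm 1 = -1/8 /\ dterm 2 = 7/256 /\ dterm 3 = -1/128.
Proof.
  assert (H0 : dterm 0 = 1) by (unfold dterm; rewrite Domb_0; simpl; field).
  assert (H1 : dterm 1 = -1/8) by (unfold dterm; rewrite Domb_1; simpl; field).
  pose proof (dterm_recurrence 0) as R0. pose proof (dterm_recurrence 1) as R1.
  simpl (INR 0) in R0. simpl (INR 1) in R1. repeat split; lra.
Qed.

Lemma is_series_dterm_weighted_from_2 :
  is_series (fun n => (3 * INR (n + 2) + 1) * dterm (n + 2)) (2 / PI - 1 / 2).
Proof.
  destruct dterm_values as (H0 & H1 & _).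
  apply (is_series_ext (fun n => (3 * INR (2 + n) + 1) * dterm (2 + n))).
  { intros n. rewrite Nat.add_comm. reflexivity. }
  apply (is_series_incr_n (fun n => (3 * INR n + 1) * dterm n) 2); [lia|].
  evar_last; [apply is_series_dterm_weighted|].
  (* The two omitted terms are 1 and [4 * (-1/8)], together [1/2]. *)
  simpl pred. rewrite !sum_Sn, sum_O, H0, H1. unfold plus. simpl. field. apply PI_neq0.
Qed.

Lemma is_series_dterm_weighted_from_0 :
  is_series (fun n => (3 * INR (n + 0) + 1) * dterm (n + 0)) (2 / PI).
Proof.
  apply (is_series_ext (fun n => (3 * INR n + 1) * dterm n)), is_series_dterm_weighted.
  intros n. rewrite Nat.add_0_r. reflexivity.
Qed.

Lemma inv_unit_interval (x : R) : 1 <= x -> 0 <= / x <= 1.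
Proof.
  intros Hx. split; [apply Rlt_le, Rinv_0_lt_compat; lra|].
  rewrite <- Rinv_1. apply Rinv_le_contravar; lra.
Qed.

(** Lets [lra] treat the powers of the inverse as independent bounded unknowns in the growth
    estimates of partial fractions. *)
Lemma inv_powers_bound (x y : R) : 1 <= x -> y = / x ->
  0 <= y <= 1 /\ 0 <= y ^ 2 <= 1 /\ 0 <= y ^ 3 <= 1.
Proof.
  intros Hx ->. pose proof (inv_unit_interval x Hx).
  repeat split; try apply pow_unit_interval; lra.
Qed.

Lemma Rabs_combination_le (c d a b M : R) :
  Rabs a <= M -> Rabs b <= M -> Rabs (c * a + d * b) <= (Rabs c + Rabs d) * M.
Proof.
  intros Ha Hb. eapply Rle_trans; [apply Rabs_triang|]. rewrite !Rabs_mult.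
  pose proof (Rabs_pos c). pose proof (Rabs_pos d). nra.
Qed.

(* In the three telescopings below [A] and [B] are given by partial fractions, so that their
   linear growth can be read off. *)
Lemma is_series_dterm_poles_1_2 (c : R -> R) (alpha c2 c3 : R) :
  (forall x, 0 <= x -> c x = alpha * (3 * x + 1) - 16 * (c2 * x + c3)
    - (2 * x + 1) * (5 * x^2 + 5 * x + 2) * (c2 / (x + 1)^2 + c3 / (x + 1)^3)
    - (x + 1)^3 * (c2 / (x + 2)^2 + c3 / (x + 2)^3)) ->
  is_series (fun n => c (INR n) * dterm n) (alpha * (2 / PI) - 16 * c3).
Proof.
  intros Hc. destruct dterm_values as (D0 & D1 & _).
  apply (is_series_ext (fun n => c (INR (n + 0)) * dterm (n + 0))).
  { intros n. rewrite Nat.add_0_r. reflexivity. }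
  evar_last.
  (* The poles of [nu] at -2 are cancelled in [B] by the leading factor of the recurrence, so only
     poles at -1 and -2 reach [c]. The factor 200 is a crude bound. *)
  - eapply (is_series_dterm_telescope 0 alpha (2 / PI) ((Rabs c2 + Rabs c3) * 200) c
      (fun x => c2 * (26 * x - 5 + 9 * / (x + 1) - 2 * (/ (x + 1))^2)
        + c3 * (26 - 15 * / (x + 1) + 9 * (/ (x + 1))^2 - 2 * (/ (x + 1))^3))
      (fun x => c2 * (16 * (x + 1)) + c3 * 16)
      (fun x => c2 / (x + 2)^2 + c3 / (x + 2)^3));
      [intros x Hx; simpl in Hx .. | apply is_series_dterm_weighted_from_0].
    1, 2: field; lra.
    1: rewrite (Hc x Hx); field; lra.
    1, 2: destruct (inv_powers_bound (x + 1) (/ (x + 1)) ltac:(lra) eq_refl) as (B1 & B2 & B3).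
    1, 2: rewrite Rmult_assoc; apply Rabs_combination_le; apply Rabs_le; lra.
  - simpl INR. rewrite D0, D1. field. apply PI_neq0.
Qed.

Lemma is_series_dterm_poles_0_pred (c : R -> R) (alpha c2 c3 : R) :
  (forall x, 2 <= x -> c x = alpha * (3 * x + 1)
    - 16 * x^3 * (c2 / (x - 1)^2 + c3 / (x - 1)^3)
    - (2 * x + 1) * (5 * x^2 + 5 * x + 2) * (c2 / x^2 + c3 / x^3)
    - (c2 * (x + 1) + c3)) ->
  is_series (fun n => c (INR (n + 2)) * dterm (n + 2))
    (alpha * (2 / PI - 1 / 2) - (15 / 4 * c2 + 29 / 8 * c3)).
Proof.
  intros Hc. destruct dterm_values as (_ & _ & D2 & D3).
  evar_last.
  (* Now the poles of [nu] at -1 are cancelled by the trailing factor [(x+1)^3] instead; poles at 0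
     and 1 remain, hence the start at 2. *)
  - eapply (is_series_dterm_telescope 2 alpha (2 / PI - 1 / 2) ((Rabs c2 + Rabs c3) * 200) c
      (fun x => c2 * (26 * x + 47 + 48 * / (x - 1) + 16 * (/ (x - 1))^2 + 9 * / x + 2 * (/ x)^2)
        + c3 * (26 + 48 * / (x - 1) + 48 * (/ (x - 1))^2 + 16 * (/ (x - 1))^3
                + 15 * / x + 9 * (/ x)^2 + 2 * (/ x)^3))
      (fun x => c2 * (16 * x + 48 + 48 * / x + 16 * (/ x)^2)
        + c3 * (16 + 48 * / x + 48 * (/ x)^2 + 16 * (/ x)^3))
      (fun x => c2 / (x + 1)^2 + c3 / (x + 1)^3));
      [intros x Hx; simpl in Hx .. | apply is_series_dterm_weighted_from_2].
    1, 2: field; lra.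
    1: rewrite (Hc x ltac:(lra)); field; lra.
    1, 2: destruct (inv_powers_bound x (/ x) ltac:(lra) eq_refl) as (B1 & B2 & B3).
    1, 2: destruct (inv_powers_bound (x - 1) (/ (x - 1)) ltac:(lra) eq_refl) as (B4 & B5 & B6).
    1, 2: rewrite Rmult_assoc; apply Rabs_combination_le; apply Rabs_le; lra.
  - replace (INR 2) with 2 by (simpl; ring). rewrite D2, D3. field. apply PI_neq0.
Qed.

Lemma is_series_dterm_poles_1_2_3 :
  is_series (fun n => let x := INR n in
     (5729 + 8701*x + 5895*x^2 + 1879*x^3 + 228*x^4) / ((x+1)^2 * (x+2)^2 * (x+3)^2) * dterm n)
    (486 / PI).
Proof.
  destruct dterm_values as (D0 & D1 & _).
  set (c := fun x => (5729 + 8701*x + 5895*x^2 + 1879*x^3 + 228*x^4)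
    / ((x+1)^2 * (x+2)^2 * (x+3)^2)).
  apply (is_series_ext (fun n => c (INR (n + 0)) * dterm (n + 0))).
  { intros n. rewrite Nat.add_0_r. reflexivity. }
  evar_last.
  (* The simple poles of [nu] have opposite residues -41 and 41, which cancels the quadratic growth
     of [A] and [B]. *)
  - eapply (is_series_dterm_telescope 0 243 (2 / PI) 5000 c
      (fun x => 16 * (27 * x + 15 - 2 * / (x + 1) - 13 * (/ (x + 1))^2)
        - 41 * (10 * (x + 1)^2 - 15 * (x + 1) + 9 - 2 * / (x + 1))
        + 55 * (10 * (x + 1) - 15 + 9 * / (x + 1) - 2 * (/ (x + 1))^2)
        + 41 * (10 * (x + 2)^2 - 45 * (x + 2) + 69 - 36 * / (x + 2))
        + 13 * (10 * (x + 2) - 45 + 69 * / (x + 2) - 36 * (/ (x + 2))^2))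
      (fun x => 16 * (27 * (x + 1) + 15 - 2 * / (x + 2) - 13 * (/ (x + 2))^2))
      (fun x => - 41 / (x + 2) + 55 / (x + 2)^2 + 41 / (x + 3) + 13 / (x + 3)^2));
      [intros x Hx; simpl in Hx .. | apply is_series_dterm_weighted_from_0].
    1, 2: field; lra.
    1: unfold c; field; lra.
    1, 2: destruct (inv_powers_bound (x + 1) (/ (x + 1)) ltac:(lra) eq_refl) as (B1 & B2 & _).
    1, 2: destruct (inv_powers_bound (x + 2) (/ (x + 2)) ltac:(lra) eq_refl) as (B3 & B4 & _).
    1, 2: apply Rabs_le; lra.
  (* The boundary contribution [A 0 - B 0 / 8] is zero, which leaves [243 * 2 / PI]. *)
  - simpl INR. rewrite D0, D1. field. apply PI_neq0.
Qed.

(* Sums starting at n = 2 are expressed by shifting the index: term (m+2). *)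
Theorem theorem4p1 :
  is_series (fun n : nat => let x := INR n in
     (27 + 103*x + 141*x^2 + 78*x^3 + 15*x^4) / ((x+1)^2 * (x+2)^2) * dterm n)
    (18 / PI)
  /\
  is_series (fun n : nat => let x := INR n in
     (239 + 807*x + 993*x^2 + 582*x^3 + 165*x^4 + 18*x^5) / ((x+1)^3 * (x+2)^3) * dterm n)
    (80 - 162 / PI)
  /\
  is_series (fun m : nat => let x := INR (m + 2) in
     (2 + 5*x - 9*x^2 - 21*x^3 + 39*x^4) / (x^2 * (x-1)^2) * dterm (m + 2))
    (-9 * (2 / PI - 11 / 12))
  /\
  is_series (fun m : nat => let x := INR (m + 2) in
     (-26 - 21*x + 105*x^2 - 9*x^3 - 147*x^4 + 306*x^5) / (x^3 * (x-1)^3) * dterm (m + 2))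
    (162 / PI - 217 / 8)
  /\
  is_series (fun n : nat => let x := INR n in
     (5729 + 8701*x + 5895*x^2 + 1879*x^3 + 228*x^4) / ((x+1)^2 * (x+2)^2 * (x+3)^2) * dterm n)
    (486 / PI).
Proof.
  pose proof PI_neq0 as Hpi.
  split; [|split; [|split; [|split]]].
  - evar_last.
    (* In all four applications [alpha = 9 c2], since the given rational function is bounded at
       infinity. In the first two, the highest-order pole at -2 has coefficient [c2] or, if present,
       [c3]. *)
    + apply (is_series_dterm_poles_1_2 (fun x => (27 + 103*x + 141*x^2 + 78*x^3 + 15*x^4)
        / ((x+1)^2 * (x+2)^2)) 9 1 0).
      intros x Hx. field. lra.
    + field. exact Hpi.
  - evar_last.
    + apply (is_series_dterm_poles_1_2 (fun x =>
        (239 + 807*x + 993*x^2 + 582*x^3 + 165*x^4 + 18*x^5)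
        / ((x+1)^3 * (x+2)^3)) (-81) (-9) (-5)).
      intros x Hx. field. lra.
    + field. exact Hpi.
  - evar_last.
    (* Here and in the next case the highest-order pole at 0 has coefficient [-2 c2], respectively
       [-2 c3]. *)
    + apply (is_series_dterm_poles_0_pred (fun x => (2 + 5*x - 9*x^2 - 21*x^3 + 39*x^4)
        / (x^2 * (x-1)^2)) (-9) (-1) 0).
      intros x Hx. field. lra.
    + field. exact Hpi.
  - evar_last.
    + apply (is_series_dterm_poles_0_pred (fun x =>
        (-26 - 21*x + 105*x^2 - 9*x^3 - 147*x^4 + 306*x^5) / (x^3 * (x-1)^3)) 81 9 (-13)).
      intros x Hx. field. lra.
    + field. exact Hpi.
  - exact is_series_dterm_poles_1_2_3.
Qed.
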